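(* Let $\mathfrak{g}$ be a real Lie algebra of dimension four which can be endowed with an ad-invariant metric. Then $\mathfrak{g}$ is isomorphic to one of the following Lie algebras: \begin{itemize} \item $\mathbb{R}^4$ (abelian); \item $\mathbb{R}\oplus\mathfrak{sl}(2,\mathbb{R})$; \item $\mathbb{R}\oplus\mathfrak{so}(3,\mathbb{R})$; \item the oscillator Lie algebra $\mathfrak{g}_0=\mathrm{span}\{e_0,e_1,e_2,e_3\}$ with the non-zero Lie brackets $$[e_0,e_1]=e_2,\qquad [e_0,e_2]=-e_1,\qquad [e_1,e_2]=e_3;$$ \item $\mathfrak{g}_1=\mathrm{span}\{e_0,e_1,e_2,e_3\}$ with the non-zero Lie brackets $$[e_0,e_1]=e_1,\qquad [e_0,e_2]=-e_2,\qquad [e_1,e_2]=e_3.$$ \end{itemize}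
   Context: An ad-invariant metric on a real Lie algebra $\mathfrak{g}$ is a non-degenerate symmetric bilinear form $\langle\,,\,\rangle$ on $\mathfrak{g}$ (of any signature) such that $\langle [X,Y],Z\rangle+\langle Y,[X,Z]\rangle=0$ for all $X,Y,Z\in\mathfrak{g}$. The direct sums are direct sums of Lie algebras. Brackets of basis vectors not listed (and not obtained from the listed ones by skew-symmetry) are zero. *)

(* Defs.v *)
From HB Require Import structures.
From mathcomp Require Import all_boot all_order all_algebra sesquilinear ring.

Set Implicit Arguments.
Unset Strict Implicit.
Unset Printing Implicit Defensive.

Import GRing.Theory.
Local Open Scope ring_scope.

HB.mixin Record isLieAlgebra (F : fieldType) (g : Type) of Vector F g := {
  lie : g -> g -> g;
  lie_bilinear : bilinear_for *:%R *:%R lie;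
  liexx : forall x, lie x x = 0;
  lie_jacobi : forall x y z,
    lie x (lie y z) + lie y (lie z x) + lie z (lie x y) = 0
}.

#[short(type="lieAlgType")]
HB.structure Definition LieAlgebra (F : fieldType) :=
  {g of isLieAlgebra F g & Vector F g}.

Notation "[lie x , y ]" := (lie x y) (format "[lie  x ,  y ]") : ring_scope.

HB.instance Definition _ (F : fieldType) (g : lieAlgType F) :=
  bilinear_isBilinear.Build F g g g *:%R *:%R (@lie F g) lie_bilinear.

Definition lie_isomorphic (F : fieldType) (g h : lieAlgType F) : Prop :=
  exists f : {linear g -> h},
    bijective f /\ (forall x y, f [lie x, y] = [lie f x, f y]).

Definition ad_invariant_metric (F : fieldType) (g : lieAlgType F)
    (b : {symmetric g}) : Prop :=
  nondegenerate b /\ (forall x y z, b [lie x, y] z + b y [lie x, z] = 0).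

Section DirectSum.
Context (F : fieldType) (g h : lieAlgType F).

Definition dsum_lie (x y : g * h) : g * h := ([lie x.1, y.1], [lie x.2, y.2]).

Fact dsum_lie_bilinear : bilinear_for *:%R *:%R dsum_lie.
Proof.
split=> [y a x x' | x a y y'].
  by congr pair; rewrite linearPl.
by congr pair; rewrite linearPr.
Qed.

Fact dsum_liexx x : dsum_lie x x = 0.
Proof. by rewrite /dsum_lie !liexx. Qed.

Fact dsum_lie_jacobi x y z :
  dsum_lie x (dsum_lie y z) + dsum_lie y (dsum_lie z x)
    + dsum_lie z (dsum_lie x y) = 0.
Proof. by congr pair; rewrite /= lie_jacobi. Qed.

HB.instance Definition _ := isLieAlgebra.Build F (g * h)%type
  dsum_lie_bilinear dsum_liexx dsum_lie_jacobi.
End DirectSum.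

Definition abelian_lie (F : fieldType) (n : nat) : Type := 'rV[F]_n.

Section Abelian.
Context (F : fieldType) (n : nat).
Local Notation g := (abelian_lie F n).

HB.instance Definition _ := Vector.on g.

Fact abelian_lie_bilinear :
  bilinear_for *:%R *:%R (fun _ _ : g => 0 : g).
Proof. by split=> ? a ? ? /=; rewrite scaler0 addr0. Qed.

Fact abelian_lie_jacobi (x y z : g) : 0 + 0 + 0 = 0 :> g.
Proof. by rewrite !addr0. Qed.

HB.instance Definition _ := isLieAlgebra.Build F g
  abelian_lie_bilinear (fun=> erefl) abelian_lie_jacobi.
End Abelian.

Section MatrixLie.
Context (F : fieldType) (n : nat).
Implicit Types (A B C : 'M[F]_n) (U : {vspace 'M[F]_n}).

Definition mxcomm A B : 'M[F]_n := A *m B - B *m A.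

Definition mxcomm_closed U := forall A B, A \in U -> B \in U -> mxcomm A B \in U.

(* When U is closed under commutators, [vsproj U] is applied to an element of
   U, so that this is the restriction of the commutator to U. *)
Definition submx_lie U (x y : subvs_of U) : subvs_of U :=
  vsproj U (mxcomm (vsval x) (vsval y)).

Lemma vsval_submx_lie U : mxcomm_closed U -> forall x y : subvs_of U,
  vsval (submx_lie x y) = mxcomm (vsval x) (vsval y).
Proof. by move=> clU x y; rewrite vsprojK // clU ?subvsP. Qed.

Fact mxcomm_bilinear : bilinear_for *:%R *:%R mxcomm.
Proof.
split=> [B a A A' | A a B B']; rewrite /= /mxcomm mulmxDl mulmxDr.
  by rewrite -scalemxAl -scalemxAr scalerBr opprD addrACA.
by rewrite -scalemxAl -scalemxAr scalerBr opprD addrACA.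
Qed.

Fact submx_lie_bilinear U : bilinear_for *:%R *:%R (@submx_lie U).
Proof.
split=> [y a x x' | x a y y']; rewrite /= /submx_lie -linearP; congr (vsproj U _).
  by rewrite linearP [LHS]mxcomm_bilinear.1.
by rewrite linearP [LHS]mxcomm_bilinear.2.
Qed.

Fact submx_liexx U (x : subvs_of U) : submx_lie x x = 0.
Proof. by rewrite /submx_lie /mxcomm subrr linear0. Qed.

Fact submx_lie_jacobi U : mxcomm_closed U -> forall x y z : subvs_of U,
  submx_lie x (submx_lie y z) + submx_lie y (submx_lie z x)
    + submx_lie z (submx_lie x y) = 0.
Proof.
move=> clU x y z; apply: val_inj.
change (vsval (submx_lie x (submx_lie y z) + submx_lie y (submx_lie z x)
    + submx_lie z (submx_lie x y)) = vsval (0 : subvs_of U)).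
rewrite !linearD linear0 /= !vsval_submx_lie //.
move: (vsval x) (vsval y) (vsval z) => A B C; rewrite /mxcomm.
rewrite !mulmxBl !mulmxBr !mulmxA; apply/matrixP=> i j; rewrite !mxE.
ring.
Qed.

Definition sl_space : {vspace 'M[F]_n} := 
  lker (linfun (@mxtrace F n : _ -> F^o)).
Definition so_space : {vspace 'M[F]_n} :=
  lker (linfun (@trmx F n n \+ idfun)).

Lemma mem_sl_space A : (A \in sl_space) = (\tr A == 0).
Proof. by rewrite memv_ker lfunE. Qed.

Lemma mem_so_space A : (A \in so_space) = (A^T == - A).
Proof. by rewrite memv_ker lfunE /= addr_eq0. Qed.

Fact sl_space_closed : mxcomm_closed sl_space.
Proof. by move=> A B _ _; rewrite mem_sl_space linearB /= mxtrace_mulC subrr. Qed.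

Fact so_space_closed : mxcomm_closed so_space.
Proof.
move=> A B; rewrite !mem_so_space => /eqP skA /eqP skB.
by rewrite linearB /= !trmx_mul skA skB !mulmxN !mulNmx !opprK opprB.
Qed.
End MatrixLie.

Definition sl (F : fieldType) (n : nat) : Type := subvs_of (sl_space F n).
Definition so (F : fieldType) (n : nat) : Type := subvs_of (so_space F n).

HB.instance Definition _ F n := Vector.on (sl F n).
HB.instance Definition _ F n := Vector.on (so F n).

HB.instance Definition _ F n := isLieAlgebra.Build F (sl F n)
  (@submx_lie_bilinear F n _) (@submx_liexx F n _)
  (submx_lie_jacobi (@sl_space_closed F n)).
HB.instance Definition _ F n := isLieAlgebra.Build F (so F n)
  (@submx_lie_bilinear F n _) (@submx_liexx F n _)
  (submx_lie_jacobi (@so_space_closed F n)).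

Section Table.
Context (F : fieldType) (n : nat).

(* The skew-symmetric bilinear extension of [e_i, e_j] = c i j for i < j; the
   values of c at i >= j are not used. *)
Definition table_lie (c : 'I_n -> 'I_n -> 'rV[F]_n) (x y : 'rV[F]_n) : 'rV[F]_n :=
  \sum_(i < n) \sum_(j < n | (i < j)%N)
    (x 0 i * y 0 j - x 0 j * y 0 i) *: c i j.

Implicit Type c : 'I_n -> 'I_n -> 'rV[F]_n.

Lemma table_lie_basis c (i j : 'I_n) :
  (i < j)%N -> table_lie c 'e_i 'e_j = c i j.
Proof.
move=> lt_ij; have ij : (i == j) = false by apply: ltn_eqF.
have eE (k l : 'I_n) : ('e_k : 'rV[F]_n) 0 l = (l == k)%:R by rewrite mxE eqxx.
rewrite /table_lie (bigD1 i) //= (bigD1 j) //= !eE !eqxx (eq_sym j i) ij.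
rewrite mul1r mul0r subr0 scale1r.
rewrite !big1 ?addr0 // => [k /negPf ki | k /andP[_ /negPf kj]]; last first.
  by rewrite !eE kj !mulr0 subr0 scale0r.
rewrite big1 // => l lt_kl; rewrite !eE ki mul0r sub0r.
have [li | _] := eqVneq l i; last by rewrite mul0r oppr0 scale0r.
have [kj | _] := eqVneq k j; last by rewrite mulr0 oppr0 scale0r.
by move: lt_kl; rewrite li kj ltnNge ltnW.
Qed.

Fact table_lie_bilinear c : bilinear_for *:%R *:%R (table_lie c).
Proof.
split=> [y a x x' | x a y y']; rewrite /= /table_lie scaler_sumr -big_split /=;
  apply: eq_bigr => i _; rewrite scaler_sumr -big_split /=;
  apply: eq_bigr => j _; rewrite scalerA -scalerDl !mxE;
  congr (_ *: _); ring.
Qed.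

Fact table_liexx c x : table_lie c x x = 0.
Proof.
rewrite /table_lie big1 // => i _; rewrite big1 // => j _.
by rewrite mulrC subrr scale0r.
Qed.
End Table.

Section FourDim.
Context (F : fieldType).
Local Notation e k := ('e_(inord k) : 'rV[F]_4).

Definition oscillator_table (i j : 'I_4) : 'rV[F]_4 :=
  match nat_of_ord i, nat_of_ord j with
  | 0, 1 => e 2
  | 0, 2 => - e 1
  | 1, 2 => e 3
  | _, _ => 0
  end.

Definition g1_table (i j : 'I_4) : 'rV[F]_4 :=
  match nat_of_ord i, nat_of_ord j with
  | 0, 1 => e 1
  | 0, 2 => - e 2
  | 1, 2 => e 3
  | _, _ => 0
  end.

Local Notation i_ k := (inord k : 'I_4).
Local Notation pl x y i j := (x 0 (i_ i) * y 0 (i_ j) - x 0 (i_ j) * y 0 (i_ i)).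

Lemma table_lie4E (c : 'I_4 -> 'I_4 -> 'rV[F]_4) (x y : 'rV[F]_4) :
  table_lie c x y =
    pl x y 0 1 *: c (i_ 0) (i_ 1) + pl x y 0 2 *: c (i_ 0) (i_ 2)
    + pl x y 0 3 *: c (i_ 0) (i_ 3) + pl x y 1 2 *: c (i_ 1) (i_ 2)
    + pl x y 1 3 *: c (i_ 1) (i_ 3) + pl x y 2 3 *: c (i_ 2) (i_ 3).
Proof.
have E m (lt_m4 : (m < 4)%N) : Ordinal lt_m4 = i_ m.
  by apply: val_inj; rewrite /= inordK.
have E0 : ord0 = i_ 0 by apply: val_inj; rewrite /= inordK.
rewrite /table_lie; under eq_bigr => i _ do rewrite big_mkcond.
rewrite !big_ord_recl !big_ord0 /= /lift /= /bump /= !E E0.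
by rewrite !add0r !addr0 !addrA.
Qed.

Lemma oscillator_tableE x y : table_lie oscillator_table x y =
  pl x y 0 1 *: e 2 - pl x y 0 2 *: e 1 + pl x y 1 2 *: e 3.
Proof.
by rewrite table_lie4E /oscillator_table !inordK // scalerN !scaler0 !addr0.
Qed.

Lemma g1_tableE x y : table_lie g1_table x y =
  pl x y 0 1 *: e 1 - pl x y 0 2 *: e 2 + pl x y 1 2 *: e 3.
Proof.
by rewrite table_lie4E /g1_table !inordK // scalerN !scaler0 !addr0.
Qed.

Let eE k l : (k < 4)%N -> (l < 4)%N -> e k 0 (i_ l) = (l == k)%:R.
Proof. by move=> k4 l4; rewrite mxE eqxx -val_eqE /= !inordK. Qed.

Let row4E (u v w : F) a b d (l : 'I_4) :
  (u *: e a - v *: e b + w *: e d) 0 l = u * e a 0 l - v * e b 0 l + w * e d 0 l.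
Proof. by rewrite ![in LHS]mxE ![in RHS]mxE. Qed.

Fact oscillator_jacobi x y z :
  table_lie oscillator_table x (table_lie oscillator_table y z)
  + table_lie oscillator_table y (table_lie oscillator_table z x)
  + table_lie oscillator_table z (table_lie oscillator_table x y) = 0.
Proof.
rewrite !oscillator_tableE !row4E !eE //=; apply/rowP=> k.
rewrite !mxE /=; ring.
Qed.

Fact g1_jacobi x y z :
  table_lie g1_table x (table_lie g1_table y z)
  + table_lie g1_table y (table_lie g1_table z x)
  + table_lie g1_table z (table_lie g1_table x y) = 0.
Proof.
rewrite !g1_tableE !row4E !eE //=; apply/rowP=> k.
rewrite !mxE /=; ring.
Qed.
End FourDim.

Definition oscillator (F : fieldType) : Type := 'rV[F]_4.
Definition g1_lie (F : fieldType) : Type := 'rV[F]_4.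

HB.instance Definition _ F := Vector.on (oscillator F).
HB.instance Definition _ F := Vector.on (g1_lie F).

HB.instance Definition _ F := isLieAlgebra.Build F (oscillator F)
  (table_lie_bilinear (@oscillator_table F)) (table_liexx _)
  (@oscillator_jacobi F).
HB.instance Definition _ F := isLieAlgebra.Build F (g1_lie F)
  (table_lie_bilinear (@g1_table F)) (table_liexx _)
  (@g1_jacobi F).

(* Main.v *)
(* Contracting the bracket with an ad-invariant metric b gives the alternating
   form (x, y, t) |-> b [x, y] t.  In dimension four an alternating 3-form has a
   nonzero kernel vector z, and z is central since b is nondegenerate.
   If b z z != 0, extend z to an orthogonal basis u1, u2, u3, z: then [u_i, u_j]
   is a multiple of u_k with coefficient w / b u_k u_k for a single scalar w, and
   rescaling yields sl(2) or so(3) according to the signs of the b u_k u_k.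
   If b z z = 0, choose y isotropic with b z y = 1 and an orthogonal basis u, v
   of the complement of span(y, z): then ad y acts on span(u, v) as an
   infinitesimal isometry and [u, v] is a multiple of z, giving the oscillator
   algebra or g_1 according to whether b is definite on span(u, v).
   In both cases the vanishing of the 3-form means that the algebra is abelian. *)

Require Import Defs.
From mathcomp Require Import all_boot all_order all_algebra sesquilinear reals.
From mathcomp Require Import boolp ring.

Set Implicit Arguments.
Unset Strict Implicit.
Unset Printing Implicit Defensive.

Import Order.TTheory GRing.Theory Num.Theory.
Local Open Scope ring_scope.

(** * Criteria for a list of vectors to be a basis *)

Section Bases.
Context (F : fieldType) (V : vectType F).

(** [Y] spans and its length equals the dimension. Every change of basis below thus reduces to
    finding the old vectors in the span of the new ones. *)
Lemma basis_of_subset_span (X Y : seq V) :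
  basis_of fullv X -> size Y = size X -> {subset X <= <<Y>>%VS} ->
  basis_of fullv Y.
Proof.
rewrite !basisEdim => /andP[fX sX] -> /span_subvP sXY.
by rewrite (subv_trans fX sXY).
Qed.

Lemma basis_of_triple (x y z : V) :
  (forall a b c, a *: x + b *: y + c *: z = 0 -> [/\ a = 0, b = 0 & c = 0]) ->
  (forall v, exists a b c, v = a *: x + b *: y + c *: z) ->
  basis_of fullv [:: x; y; z].
Proof.
move=> indep gen; apply/andP; split.
  rewrite eqEsubv subvf /=; apply/subvP => v _; have [a [b [c ->]]] := gen v.
  by rewrite !rpredD // rpredZ // memv_span // !inE eqxx ?orbT.
change (free [tuple x; y; z]); apply/freeP => k.
rewrite !big_ord_recl big_ord0 /= addr0 addrA => /indep[k0 k1 k2] i.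
by case: i => -[|[|[|//]]] lti; [rewrite -[RHS]k0|rewrite -[RHS]k1|rewrite -[RHS]k2];
  congr (k _); apply: val_inj.
Qed.

Lemma mem_span_scaled (a : F) (x : V) (X : seq V) :
  a != 0 -> a *: x \in X -> x \in <<X>>%VS.
Proof. by move=> a_nz /memv_span; rewrite rpredZeq (negPf a_nz). Qed.

End Bases.

(** * Bilinearity and skew-symmetry of the bracket *)

Section LieTheory.
Context (F : fieldType) (g : lieAlgType F).
Implicit Types x y z : g.

Lemma lieDl x y z : [lie x + y, z] = [lie x, z] + [lie y, z].
Proof. exact: linearDl. Qed.

Lemma lieDr x y z : [lie x, y + z] = [lie x, y] + [lie x, z].
Proof. exact: linearDr. Qed.

Lemma lieNl x y : [lie - x, y] = - [lie x, y].
Proof. exact: linearNl. Qed.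

Lemma lieNr x y : [lie x, - y] = - [lie x, y].
Proof. exact: linearNr. Qed.

Lemma lieZl a x y : [lie a *: x, y] = a *: [lie x, y].
Proof. exact: linearZl_LR. Qed.

Lemma lieZr a x y : [lie x, a *: y] = a *: [lie x, y].
Proof. exact: linearZr_LR. Qed.

Lemma lie0r x : [lie x, 0] = 0.
Proof. exact: linear0r. Qed.

Lemma lie_suml n (X : 'I_n -> g) y :
  [lie \sum_i X i, y] = \sum_i [lie X i, y].
Proof. exact: linear_sumlz. Qed.

Lemma lie_sumr n x (Y : 'I_n -> g) :
  [lie x, \sum_i Y i] = \sum_i [lie x, Y i].
Proof. exact: linear_sumr. Qed.

Lemma lieC x y : [lie x, y] = - [lie y, x].
Proof.
apply/eqP; rewrite -addr_eq0; have := liexx (x + y).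
by rewrite lieDl !lieDr !liexx add0r addr0 => ->.
Qed.

End LieTheory.

(** * Lie isomorphisms from bases with matching brackets *)

Section Isomorphisms.
Context (F : fieldType).

(** The linear maps exchanging [X] and [Y] are mutually inverse; skew-symmetry and bilinearity
    extend the bracket identity from i < j to all vectors. The last hypothesis quantifies over [f]
    so that a bracket expanded in [X] can be evaluated from the values of [f] on [X] alone. *)
Lemma lie_isomorphic_of_bases (g h : lieAlgType F) n
    (X : n.-tuple g) (Y : n.-tuple h) :
  basis_of fullv X -> basis_of fullv Y ->
  (forall f : {linear g -> h}, (forall i : 'I_n, f X`_i = Y`_i) ->
   forall i j : 'I_n, (i < j)%N -> f [lie X`_i, X`_j] = [lie Y`_i, Y`_j]) ->
  lie_isomorphic g h.
Proof.
move=> bX bY br.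
have [f /(_ (basis_free bX)) fXY] := linear_of_free X Y.
have [f' /(_ (basis_free bY)) fYX] := linear_of_free Y X.
have fE (i : 'I_n) : f X`_i = Y`_i.
  by rewrite -fXY ?size_tuple // (nth_map 0) ?size_tuple.
have fE' (i : 'I_n) : f' Y`_i = X`_i.
  by rewrite -fYX ?size_tuple // (nth_map 0) ?size_tuple.
exists f; split.
  exists f' => v;
    [rewrite (coord_basis bX (memvf v))|rewrite (coord_basis bY (memvf v))];
    by rewrite !linear_sum; apply: eq_bigr => i _; rewrite !linearZ /= ?fE ?fE' ?fE.
have fbr (i j : 'I_n) : f [lie X`_i, X`_j] = [lie Y`_i, Y`_j].
  have [/br-> //|/br ji|/val_inj ->] := ltngtP i j.
    by rewrite lieC linearN ji // -lieC.
  by rewrite !liexx linear0.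
move=> x y.
rewrite (coord_basis bX (memvf x)) (coord_basis bX (memvf y)).
rewrite lie_suml !linear_sum lie_suml; apply: eq_bigr => i _.
rewrite lie_sumr !linear_sum lie_sumr; apply: eq_bigr => j _.
by rewrite lieZl lieZr !linearZ /= lieZl lieZr !fE fbr.
Qed.

Lemma lie_isomorphic_dim4 (g h : lieAlgType F)
    (x0 x1 x2 x3 : g) (y0 y1 y2 y3 : h) :
  basis_of fullv [:: x0; x1; x2; x3] -> basis_of fullv [:: y0; y1; y2; y3] ->
  (forall f : {linear g -> h},
     [/\ f x0 = y0, f x1 = y1, f x2 = y2 & f x3 = y3] ->
   [/\ f [lie x0, x1] = [lie y0, y1], f [lie x0, x2] = [lie y0, y2]
     & f [lie x0, x3] = [lie y0, y3]] /\
   [/\ f [lie x1, x2] = [lie y1, y2], f [lie x1, x3] = [lie y1, y3]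
     & f [lie x2, x3] = [lie y2, y3]]) ->
  lie_isomorphic g h.
Proof.
move=> bX bY br.
apply: (@lie_isomorphic_of_bases g h 4 [tuple x0; x1; x2; x3]
  [tuple y0; y1; y2; y3] bX bY) => f fE.
have [] := br f.
  by split; [exact: (fE (@Ordinal 4 0 isT))|exact: (fE (@Ordinal 4 1 isT))|
    exact: (fE (@Ordinal 4 2 isT))|exact: (fE (@Ordinal 4 3 isT))].
by move=> [? ? ?] [? ? ?] [[|[|[|[|//]]]] ?] [[|[|[|[|//]]]] ?].
Qed.

End Isomorphisms.

(** * Orthogonal bases for a symmetric form, 2 being invertible *)

Section OrthogonalBases.
Context (F : fieldType) (V : vectType F) (b : {symmetric V}).
Hypothesis nz2 : 2 != 0 :> F.
Implicit Types (x y u v w : V) (X Y : seq V).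

Lemma symmetric_formC u v : b u v = b v u.
Proof. by rewrite hermC expr0 mul1r. Qed.

Lemma formZl a u v : b (a *: u) v = a * b u v.
Proof. exact: linearZl_LR. Qed.

Lemma formZr a u v : b u (a *: v) = a * b u v.
Proof. exact: linearZr_LR. Qed.

Lemma formDl u v w : b (u + v) w = b u w + b v w.
Proof. exact: linearDl. Qed.

Lemma formDr u v w : b u (v + w) = b u v + b u w.
Proof. exact: linearDr. Qed.

Lemma formBl u v w : b (u - v) w = b u w - b v w.
Proof. exact: linearBl. Qed.

Lemma formBr u v w : b u (v - w) = b u v - b u w.
Proof. exact: linearBr. Qed.

Lemma formNl u v : b (- u) v = - b u v.
Proof. exact: linearNl. Qed.

Lemma formNr u v : b u (- v) = - b u v.
Proof. exact: linearNr. Qed.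

Lemma form0l u : b 0 u = 0.
Proof. exact: linear0l. Qed.

Lemma nondegenerate_eq u v :
  nondegenerate b -> (forall w, b u w = b v w) -> u = v.
Proof.
move=> /eqP ndg uv; apply/eqP; rewrite -subr_eq0 -memv0 -ndg.
by apply/mem_orthovP => w _; rewrite formBl uv subrr.
Qed.

Lemma form_span_eq0 X v w :
  {in X, forall x, b v x = 0} -> w \in <<X>>%VS -> b v w = 0.
Proof.
move=> vX; have : (<<X>> <= orthov b <[v]>)%VS.
  by apply/span_subvP => x /vX bvx; rewrite mem_orthov1 symmetric_formC bvx.
by move/subvP=> /[apply]; rewrite mem_orthov1 symmetric_formC => /eqP.
Qed.

Lemma eq_form_basis X u v :
  nondegenerate b -> basis_of fullv X -> {in X, forall x, b u x = b v x} ->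
  u = v.
Proof.
move=> ndg bX uv; apply: nondegenerate_eq => // w.
apply/eqP; rewrite -subr_eq0 -formBl; apply/eqP; apply: (@form_span_eq0 X).
  by move=> x /uv uvx; rewrite formBl uvx subrr.
by rewrite (span_basis bX) memvf.
Qed.

(** Each vector is tested against the later ones only, symmetry giving the rest, so that a family is
    extended by prepending. *)
Fixpoint nonisotropic_orthogonal X : bool :=
  if X is x :: X' then
    [&& b x x != 0, all (fun y => b x y == 0) X' & nonisotropic_orthogonal X']
  else true.

(** A vector in the span of the later ones would be orthogonal to itself. *)
Lemma nonisotropic_orthogonal_free X : nonisotropic_orthogonal X -> free X.
Proof.
elim: X => [|x X IH] /=; first by rewrite nil_free.
move=> /and3P[xx /allP xX /IH fX]; rewrite free_cons fX andbT.
apply: contra xx => /form_span_eq0->// y /xX /eqP //.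
Qed.

(** Gram-Schmidt, one vector at a time: as [x] is orthogonal to the tail, adding its component
    leaves the pairings with the tail unchanged. *)
Lemma orthogonal_projection X v : nonisotropic_orthogonal X ->
  exists2 s, s \in <<X>>%VS & {in X, forall x, b (v - s) x = 0}.
Proof.
elim: X => [|x X IH] /=; first by exists 0; rewrite ?mem0v.
move=> /and3P[xx /allP xX /IH[s sX vsX]].
exists (s + (b v x / b x x) *: x).
  rewrite span_cons rpredD //.
    by apply: subvP sX; apply: addvSr.
  by apply: (subvP (addvSl _ _)); rewrite rpredZ ?memv_line.
move=> y; rewrite inE opprD addrA => /predU1P[->|yX].
  have sx : b s x = 0.
    rewrite symmetric_formC; apply: form_span_eq0 sX => y' /xX /eqP //.
  by rewrite 2!formBl sx subr0 formZl divfK // subrr.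
by rewrite formBl vsX // formZl (eqP (xX y yX)) mulr0 subr0.
Qed.

(* If every vector orthogonal to X were isotropic, b would vanish on the
   orthogonal complement of X by polarisation, so by nondegeneracy this
   complement would be zero and X would span V. *)
Lemma orthogonal_extend X : nondegenerate b -> nonisotropic_orthogonal X ->
  (size X < \dim {:V})%N -> exists x, nonisotropic_orthogonal (x :: X).
Proof.
move=> ndg oX ltX; apply: contrapT => noX.
have iso x : {in X, forall y, b x y = 0} -> b x x = 0.
  move=> xX; apply/eqP/negP=> /negP xx; apply: noX; exists x.
  by rewrite /= xx oX andbT /=; apply/allP => y /xX /eqP.
have iso2 u v : {in X, forall y, b u y = 0} -> {in X, forall y, b v y = 0} ->
    b u v = 0.
  move=> uX vX; have : b (u + v) (u + v) = 0.
    by apply: iso => y yX; rewrite formDl uX ?vX ?addr0.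
  rewrite formDl !formDr !iso // add0r addr0 (symmetric_formC v u).
  by rewrite -mulr2n -mulr_natl => /eqP; rewrite mulf_eq0 (negPf nz2) => /eqP.
have fullX : (fullv <= <<X>>)%VS.
  apply/subvP => v _; have [s sX vs] := orthogonal_projection v oX.
  suff -> : v = s by [].
  apply/eqP; rewrite -subr_eq0; apply/eqP/nondegenerate_eq => // w.
  have [t tX wt] := orthogonal_projection w oX.
  rewrite -[w](subrK t) formDr iso2 // (form_span_eq0 vs tX).
  by rewrite addr0 form0l.
by move: (leq_trans (dimvS fullX) (dim_span X)); rewrite leqNgt ltX.
Qed.

(** Induction on the codimension: prepend vectors until the length reaches the dimension, when
    freeness makes the family a basis. *)
Lemma orthogonal_basis_extend X : nondegenerate b -> nonisotropic_orthogonal X ->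
  exists Y, basis_of fullv (Y ++ X) /\ nonisotropic_orthogonal (Y ++ X).
Proof.
move=> ndg; have [n] := ubnP (\dim {:V} - size X)%N.
elim: n X => // n IH X ltn oX.
have [ltX|leX] := ltnP (size X) (\dim {:V}).
  have [x oxX] := orthogonal_extend ndg oX ltX.
  have [|Y] := IH (x :: X) _ oxX; last by rewrite -cat_rcons => ?; exists (rcons Y x).
  by rewrite /= subnS -ltnS prednK ?subn_gt0.
exists [::]; split=> //=.
by rewrite basisEfree nonisotropic_orthogonal_free // subvf.
Qed.

End OrthogonalBases.

(** * Central vectors and bracket tables under an ad-invariant metric *)

Section AdInvariantMetrics.
Context (F : fieldType) (g : lieAlgType F) (b : {symmetric g}).
Hypotheses (nz2 : 2 != 0 :> F) (ad_b : ad_invariant_metric b).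
Implicit Types x y z : g.

Let nondeg_b : nondegenerate b := ad_b.1.

Lemma form_lieC12 x y z : b [lie y, x] z = - b [lie x, y] z.
Proof. by rewrite lieC formNl. Qed.

Lemma form_lieC23 x y z : b [lie x, z] y = - b [lie x, y] z.
Proof. by apply/eqP; rewrite -addr_eq0 addrC (symmetric_formC _ _ y) ad_b.2. Qed.

(** The form b [x, y] z changes sign under both adjacent transpositions, which generate all
    permutations. The tuple is made for rewriting. *)
Lemma form_lie_perm x y z :
  ((b [lie y, x] z = - b [lie x, y] z) * (b [lie x, z] y = - b [lie x, y] z) *
   (b [lie z, y] x = - b [lie x, y] z) * (b [lie y, z] x = b [lie x, y] z) *
   (b [lie z, x] y = b [lie x, y] z))%type.
Proof.
do !split; first exact: form_lieC12.
- exact: form_lieC23.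
- by rewrite form_lieC23 form_lieC12 form_lieC23 opprK.
- by rewrite form_lieC23 form_lieC12 opprK.
- by rewrite form_lieC12 form_lieC23 opprK.
Qed.

Lemma form_lie_r x y : b [lie x, y] y = 0.
Proof.
have /eqP := form_lieC23 x y y; rewrite -addr_eq0 -mulr2n -mulr_natl mulf_eq0.
by rewrite (negPf nz2) => /eqP.
Qed.

Lemma form_lie_l x y : b [lie x, y] x = 0.
Proof. by rewrite form_lieC12 form_lie_r oppr0. Qed.

Lemma form_lie_central z x y : (forall x, [lie z, x] = 0) -> b [lie x, y] z = 0.
Proof. by move=> zC; rewrite (form_lie_perm z x y) zC form0l. Qed.

(** Nondegeneracy gives [z, y] = 0 for [y] in the basis; then b [z, x] y = - b [z, y] x = 0 for
    arbitrary [x]. *)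
Lemma central_of_basis X z : basis_of fullv X ->
  {in X &, forall x y, b [lie z, x] y = 0} -> forall x, [lie z, x] = 0.
Proof.
move=> bX zX x; apply: (eq_form_basis nondeg_b bX) => y yX.
rewrite form_lieC23 form0l; suff -> : [lie z, y] = 0 by rewrite form0l oppr0.
by apply: (eq_form_basis nondeg_b bX) => y' y'X; rewrite zX // form0l.
Qed.

(* The kernel vector of an alternating 3-form w on a 4-dimensional space is
   w123 x0 - w023 x1 + w013 x2 - w012 x3; if it vanishes then w = 0, and every
   vector is central. *)
Lemma exists_central : \dim {:g} = 4%N ->
  exists2 z : g, z != 0 & forall x, [lie z, x] = 0.
Proof.
move=> dim_g; have := vbasisP {:g}; move: (vbasis _) => X; rewrite dim_g in X *.
case: X => -[|x0 [|x1 [|x2 [|x3 [|//]]]]] //= _ bX.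
pose w123 := b [lie x1, x2] x3; pose w023 := b [lie x0, x2] x3.
pose w013 := b [lie x0, x1] x3; pose w012 := b [lie x0, x1] x2.
pose z := w123 *: x0 - w023 *: x1 + w013 *: x2 - w012 *: x3.
have permE := (form_lie_perm x1 x2 x3, form_lie_perm x0 x2 x3,
  form_lie_perm x0 x1 x3, form_lie_perm x0 x1 x2, form_lie_r, form_lie_l,
  @liexx F g, form0l b).
have zx x : [lie z, x] = 0.
  apply: (central_of_basis bX) x => x y.
  rewrite !inE => /or4P[] /eqP-> /or4P[] /eqP->;
  rewrite /z !(lieDl, lieNl, lieZl) !(formDl, formNl, formZl) !permE
    /w123 /w023 /w013 /w012; ring.
have [z0|] := eqVneq z 0; last by exists z.
have w0 (i : 'I_4) : [:: w123; - w023; w013; - w012]`_i = 0.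
  have fX : free [tuple x0; x1; x2; x3] := basis_free bX.
  move/freeP/(_ (fun i : 'I_4 => [:: w123; - w023; w013; - w012]`_i)): fX; apply.
  by rewrite !big_ord_recl big_ord0 /= addr0 !scaleNr !addrA -[RHS]z0.
have {}w0 : (w123 = 0) * (w023 = 0) * (w013 = 0) * (w012 = 0).
  have /= [] := (w0 (@Ordinal 4 0 isT), w0 (@Ordinal 4 2 isT)); split; last first.
    by apply/eqP; rewrite -oppr_eq0; apply/eqP/(w0 (@Ordinal 4 3 isT)).
  do 2?split=> //.
  by apply/eqP; rewrite -oppr_eq0; apply/eqP/(w0 (@Ordinal 4 1 isT)).
exists x0; first by apply: (basis_not0 bX); rewrite inE eqxx.
apply: (central_of_basis bX) => x y.
by rewrite !inE => /or4P[] /eqP-> /or4P[] /eqP->; rewrite ?permE;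
  rewrite -/w123 -/w023 -/w013 -/w012 ?w0 ?oppr0.
Qed.

(** [u2, u3] is orthogonal to u2 and u3 by alternation and to [z] by centrality, so only its pairing
    with u1 survives. The three such pairings are equal by cyclic symmetry, whence a single [w]. *)
Lemma metric_central_nonisotropic (z : g) : \dim {:g} = 4%N ->
  (forall x, [lie z, x] = 0) -> b z z != 0 ->
  exists u1 u2 u3 : g, basis_of fullv [:: u1; u2; u3; z] /\
  exists w q1 q2 q3 : F, [/\ q1 != 0, q2 != 0 & q3 != 0] /\
  [/\ [lie u2, u3] = (w / q1) *: u1, [lie u3, u1] = (w / q2) *: u2
    & [lie u1, u2] = (w / q3) *: u3].
Proof.
move=> dim_g zC nz_z.
have [|Y [bY oY]] := @orthogonal_basis_extend _ _ b nz2 [:: z] nondeg_b.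
  by rewrite /= nz_z.
have : size (Y ++ [:: z]) = 4%N.
  by rewrite -dim_g -(eqnP (basis_free bY)) (span_basis bY).
rewrite size_cat addn1 => -[].
case: Y bY oY => [|u1 [|u2 [|u3 [|//]]]] //= bY.
rewrite !andbT => /and3P[q1 /and3P[/eqP o12 /eqP o13 /eqP o1z]].
move=> /and4P[q2 /andP[/eqP o23 /eqP o2z]] q3 /andP[/eqP o3z _] _.
exists u1, u2, u3; split=> //.
exists (b [lie u1, u2] u3), (b u1 u1), (b u2 u2), (b u3 u3); do !split=> //;
  apply: (eq_form_basis nondeg_b bY) => x; rewrite !inE => /or4P[] /eqP->.
all: rewrite formZl ?(@form_lie_central z) // ?(symmetric_formC _ u2 u1)
  ?(symmetric_formC _ u3 u1) ?(symmetric_formC _ u3 u2) ?o12 ?o13 ?o23 ?o1z ?o2z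
  ?o3z ?mulr0.
all: by rewrite ?form_lie_l ?form_lie_r ?divfK ?(form_lie_perm u1 u2 u3).
Qed.

Lemma metric_central_isotropic (z : g) : \dim {:g} = 4%N ->
  (forall x, [lie z, x] = 0) -> z != 0 -> b z z = 0 ->
  exists y u v : g, basis_of fullv [:: y; u; v; z] /\
  exists c q r : F, [/\ q != 0, r != 0
    & [/\ [lie y, u] = (c / r) *: v, [lie y, v] = - (c / q) *: u
        & [lie u, v] = c *: z]].
Proof.
move=> dim_g zC nz_z zz.
have [w zw] : exists w, b z w != 0.
  apply: contrapT => noW; case/eqP: nz_z; apply: nondegenerate_eq nondeg_b _ => w.
  by rewrite form0l; apply/eqP/negP => /negP zw; apply: noW; exists w.
have [y zy yy] : exists2 y, b z y = 1 & b y y = 0.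
  have [y0 zy0] : exists y0, b z y0 = 1.
    by exists ((b z w)^-1 *: w); rewrite formZr mulVf.
  (* As [z] is isotropic, subtracting t z keeps the pairing with [z] and lowers b y0 y0 by 2 t. *)
  exists (y0 - (b y0 y0 / 2) *: z); rewrite !(formBl, formBr, formZl, formZr) zz.
    by rewrite zy0 mulr0 subr0.
  by rewrite (symmetric_formC _ y0 z) zy0; field.
(* The isotropic pair y, z cannot itself belong to an orthogonal basis of nonisotropic vectors; z +
   y and z - y, of norms 2 and -2, span the same plane and can. *)
have [|Y [bY oY]] :=
    @orthogonal_basis_extend _ _ b nz2 [:: z + y; z - y] nondeg_b.
  rewrite /= !(formDl, formDr, formNl, formNr) zz yy (symmetric_formC _ y z) zy.
  by rewrite oppr0 !(addr0, add0r) subr0 addNr eqxx -opprD oppr_eq0 -mulr2n nz2.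
have : size (Y ++ [:: z + y; z - y]) = 4%N.
  by rewrite -dim_g -(eqnP (basis_free bY)) (span_basis bY).
rewrite size_cat addn2 => -[].
case: Y bY oY => [|u [|v [|//]]] //= bY.
rewrite !andbT => /and3P[q /and3P[/eqP uv /eqP up /eqP um]].
move=> /and3P[r /andP[/eqP vp /eqP vm] _] _.
have half x : b x (z + y) = 0 -> b x (z - y) = 0 -> b x z = 0 /\ b x y = 0.
  rewrite formDr formBr => hp hm.
  have xz : b x z = 0.
    by apply: (mulfI nz2); rewrite mulr0 -[RHS]addr0 -{1}hp -hm; ring.
  by split=> //; rewrite -hp xz add0r.
have [uz uy] := half u up um; have [vz vy] := half v vp vm.
have bY' : basis_of fullv [:: y; u; v; z].
  apply: basis_of_subset_span bY _ _ => // x; rewrite !inE => xE.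
  by case/or4P: xE => /eqP->; rewrite ?rpredB ?rpredD // memv_span // !inE eqxx ?orbT.
(* [u, v] pairs only with [y], hence is a multiple of [z], the vector dual to [y]; [y, u] pairs only
   with [v], and [y, v] only with [u]. *)
exists y, u, v; split=> //; exists (b [lie u, v] y), (b u u), (b v v).
do !split=> //;
  apply: (eq_form_basis nondeg_b bY') => x; rewrite !inE => /or4P[] /eqP->.
all: rewrite formZl ?(@form_lie_central z) // ?(symmetric_formC _ v u)
  ?(symmetric_formC _ y z)
  ?(symmetric_formC _ z u) ?(symmetric_formC _ z v) ?uv ?uy ?uz ?vy ?vz ?zz ?zy ?mulr0.
all: by rewrite ?form_lie_l ?form_lie_r ?mulNr ?divfK ?mulr1 ?(form_lie_perm u v y).
Qed.

End AdInvariantMetrics.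

(** * Explicit bases of the model algebras *)

Section Models.
Context (F : fieldType).

Lemma delta_basis4 : basis_of (fullv : {vspace 'rV[F]_4})
  [:: 'e_(inord 0); 'e_(inord 1); 'e_(inord 2); 'e_(inord 3)].
Proof.
rewrite basisEdim dimvf /dim /= mul1n leqnn andbT; apply/subvP => v _.
rewrite (row_sum_delta v); apply: rpred_sum => i _; rewrite rpredZ // memv_span //.
rewrite -[i]inord_val; case: i => -[|[|[|[|//]]]] lti /=;
  by rewrite !inE eqxx ?orbT.
Qed.

Local Notation o30 := (@Ordinal 3 0 isT).
Local Notation o31 := (@Ordinal 3 1 isT).
Local Notation o32 := (@Ordinal 3 2 isT).
Local Notation o20 := (@Ordinal 2 0 isT).
Local Notation o21 := (@Ordinal 2 1 isT).

Lemma ord3P (i : 'I_3) : [\/ i = o30, i = o31 | i = o32].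
Proof.
by case: i => -[|[|[|//]]] lti;
  [apply: Or31|apply: Or32|apply: Or33]; apply: val_inj.
Qed.

Lemma ord2P (i : 'I_2) : i = o20 \/ i = o21.
Proof. by case: i => -[|[|//]] lti; [left|right]; apply: val_inj. Qed.

(* The matrix of the cross product with (a, b, c). *)
Definition so3_mx (a b c : F) : 'M[F]_3 := \matrix_(i, j)
  (nth [::] [:: [:: 0; - c; b]; [:: c; 0; - a]; [:: - b; a; 0]] i)`_j.

Lemma so3_mx_in a b c : so3_mx a b c \in so_space F 3.
Proof.
rewrite mem_so_space; apply/eqP/matrixP => i j.
by have [] := ord3P i => ->; have [] := ord3P j => ->; rewrite !mxE /= ?oppr0 ?opprK.
Qed.

Definition so3_vec a b c : so F 3 := vsproj (so_space F 3) (so3_mx a b c).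

Lemma val_so3_vec a b c : vsval (so3_vec a b c) = so3_mx a b c.
Proof. exact/vsprojK/so3_mx_in. Qed.

Lemma so3_vecE a b c : so3_vec a b c =
  a *: so3_vec 1 0 0 + b *: so3_vec 0 1 0 + c *: so3_vec 0 0 1.
Proof.
rewrite /so3_vec -!linearZ -!linearD; congr (vsproj _ _); apply/matrixP => i j.
have [] := ord3P i => ->; have [] := ord3P j => ->; rewrite !mxE /=; ring.
Qed.

(** The coefficients on the right are those of the cross product. *)
Lemma lie_so3_vec a b c a' b' c' : [lie so3_vec a b c, so3_vec a' b' c'] =
  so3_vec (b * c' - c * b') (c * a' - a * c') (a * b' - b * a').
Proof.
apply: val_inj; rewrite [LHS]vsval_submx_lie ?[RHS]val_so3_vec ?val_so3_vec;
  last exact: so_space_closed.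
apply/matrixP => i j; rewrite /mxcomm !mxE !big_ord_recl !big_ord0 !mxE.
have [] := ord3P i => ->; have [] := ord3P j => ->; rewrite /=; ring.
Qed.

Hypothesis nz2 : 2 != 0 :> F.

Lemma so3_basis :
  basis_of fullv [:: so3_vec 1 0 0; so3_vec 0 1 0; so3_vec 0 0 1].
Proof.
apply: basis_of_triple => [a b c|v].
  rewrite -so3_vecE => /(congr1 vsval); rewrite val_so3_vec linear0 => /matrixP A0.
  by have := (A0 o32 o31, A0 o30 o32, A0 o31 o30); rewrite !mxE => -[[]].
pose A := vsval v.
have skA i j : A i j = - A j i.
  have : A \in so_space F 3 by apply: subvsP.
  by rewrite mem_so_space => /eqP/matrixP/(_ j i); rewrite !mxE.
have diag i : A i i = 0.
  have /eqP := skA i i.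
  by rewrite -addr_eq0 -mulr2n -mulr_natl mulf_eq0 (negPf nz2) => /eqP.
(* The positions where [so3_mx] carries a, b, c without sign. *)
exists (A o32 o31), (A o30 o32), (A o31 o30).
rewrite -so3_vecE; apply: val_inj; rewrite [RHS]val_so3_vec.
apply/matrixP => i j; rewrite !mxE.
have [] := ord3P i => ->; have [] := ord3P j => ->; rewrite /= ?diag //.
all: exact: skA.
Qed.

(* The basis (E + F) / 2, H / 2, (E - F) / 2 of sl(2), whose bracket table is
   that of so(3) up to the sign of [x1, x2]. *)
Definition sl2_mx (a b c : F) : 'M[F]_2 := \matrix_(i, j)
  (nth [::] [:: [:: b / 2; (a + c) / 2]; [:: (a - c) / 2; - b / 2]] i)`_j.

Lemma sl2_mx_in a b c : sl2_mx a b c \in sl_space F 2.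
Proof.
rewrite mem_sl_space /mxtrace !big_ord_recl big_ord0 !mxE /=.
by apply/eqP; ring.
Qed.

Definition sl2_vec a b c : sl F 2 := vsproj (sl_space F 2) (sl2_mx a b c).

Lemma val_sl2_vec a b c : vsval (sl2_vec a b c) = sl2_mx a b c.
Proof. exact/vsprojK/sl2_mx_in. Qed.

Lemma sl2_vecE a b c : sl2_vec a b c =
  a *: sl2_vec 1 0 0 + b *: sl2_vec 0 1 0 + c *: sl2_vec 0 0 1.
Proof.
rewrite /sl2_vec -!linearZ -!linearD; congr (vsproj _ _); apply/matrixP => i j.
have [] := ord2P i => ->; have [] := ord2P j => ->; rewrite !mxE /=; ring.
Qed.

Lemma lie_sl2_vec a b c a' b' c' : [lie sl2_vec a b c, sl2_vec a' b' c'] =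
  sl2_vec (b * c' - c * b') (c * a' - a * c') (b * a' - a * b').
Proof.
apply: val_inj; rewrite [LHS]vsval_submx_lie ?[RHS]val_sl2_vec ?val_sl2_vec;
  last exact: sl_space_closed.
apply/matrixP => i j; rewrite /mxcomm !mxE !big_ord_recl !big_ord0 !mxE.
by have [] := ord2P i => ->; have [] := ord2P j => ->; rewrite /=; field.
Qed.

Lemma sl2_basis :
  basis_of fullv [:: sl2_vec 1 0 0; sl2_vec 0 1 0; sl2_vec 0 0 1].
Proof.
apply: basis_of_triple => [a b c|v].
  rewrite -sl2_vecE => /(congr1 vsval); rewrite val_sl2_vec linear0 => /matrixP A0.
  have := (A0 o20 o20, A0 o20 o21, A0 o21 o20); rewrite !mxE /= => -[[h1 h2] h3].
  have hb : b = 2 * (b / 2) by field.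
  have ha : a = (a + c) / 2 + (a - c) / 2 by field.
  have hc : c = (a + c) / 2 - (a - c) / 2 by field.
  by split; [rewrite ha h2 h3 addr0|rewrite hb h1 mulr0|rewrite hc h2 h3 subr0].
pose A := vsval v.
have trA : A o21 o21 = - A o20 o20.
  have : A \in sl_space F 2 by apply: subvsP.
  rewrite mem_sl_space /mxtrace !big_ord_recl big_ord0 addr0 addrC addr_eq0.
  have -> : ord0 = o20 :> 'I_2 by apply: val_inj.
  have -> : lift o20 ord0 = o21 :> 'I_2 by apply: val_inj.
  by move/eqP.
(* Solves (a + c) / 2, (a - c) / 2 and b / 2 for a, b, c. *)
exists (A o20 o21 + A o21 o20), (2 * A o20 o20), (A o20 o21 - A o21 o20).
rewrite -sl2_vecE; apply: val_inj; rewrite [RHS]val_sl2_vec.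
apply/matrixP => i j; rewrite !mxE.
have [] := ord2P i => ->; have [] := ord2P j => ->; rewrite /= ?trA; field => //.
Qed.

(** Spanning suffices, the dimension being 1 + 3. The central generator comes last, to match the
    bases u1, u2, u3, z. *)
Lemma dsum_abelian1_basis (h : lieAlgType F) (y1 y2 y3 : h) :
  basis_of fullv [:: y1; y2; y3] ->
  basis_of (fullv : {vspace (abelian_lie F 1 * h)%type})
    [:: (0, y1); (0, y2); (0, y3); (const_mx 1, 0)].
Proof.
move=> bY; rewrite basisEdim; apply/andP; split; last first.
  have dh : \dim {:h} = 3 by rewrite -(span_basis bY) (eqnP (basis_free bY)).
  by rewrite dimvf /dim /= -[X in (_ + X)%N]dimvf dh.
apply/subvP => -[a y] _.
have -> : (a, y) = a 0 0 *: (const_mx 1, 0) + (0, y) :> (abelian_lie F 1 * h).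
  congr pair; rewrite /= ?scaler0 ?add0r // addr0.
  by apply/matrixP => i j; rewrite !mxE !ord1 mulr1.
have [k ->] : exists k : 'I_3 -> F, y = \sum_i k i *: [:: y1; y2; y3]`_i.
  have bY' : basis_of fullv [tuple y1; y2; y3] := bY.
  by exists (fun i => coord [tuple y1; y2; y3] i y); apply: coord_basis bY' (memvf y).
rewrite !big_ord_recl big_ord0 /= addr0.
set k0 := k _; set k1 := k _; set k2 := k _.
have -> : (0, k0 *: y1 + (k1 *: y2 + k2 *: y3)) =
    k0 *: (0, y1) + (k1 *: (0, y2) + k2 *: (0, y3)) :> (abelian_lie F 1 * h).
  by congr pair; rewrite /= !scaler0 !addr0.
by rewrite !rpredD // rpredZ // memv_span // !inE eqxx ?orbT.
Qed.

End Models.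

(** * Normal forms, by rescaling with square roots *)

Section Classification.
Context (R : rcfType) (g : lieAlgType R).
Implicit Types (u v y z : g).

Let nz2 : 2 != 0 :> R.
Proof. by rewrite pnatr_eq0. Qed.

Lemma abelian4_isomorphic (x0 x1 x2 x3 : g) :
  basis_of fullv [:: x0; x1; x2; x3] ->
  [/\ [lie x0, x1] = 0, [lie x0, x2] = 0 & [lie x0, x3] = 0] ->
  [/\ [lie x1, x2] = 0, [lie x1, x3] = 0 & [lie x2, x3] = 0] ->
  lie_isomorphic g (abelian_lie R 4).
Proof.
move=> bX [h01 h02 h03] [h12 h13 h23].
apply: (@lie_isomorphic_dim4 _ g (abelian_lie R 4) _ _ _ _ _ _ _ _
  bX (delta_basis4 R)) => f _.
by rewrite h01 h02 h03 h12 h13 h23 linear0.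
Qed.

(** Treats so(3), with e = 1, and sl(2), with e = -1, at once. *)
Lemma dsum_abelian1_isomorphic (h : lieAlgType R) (u1 u2 u3 z : g)
    (y1 y2 y3 : h) (e : R) :
  basis_of fullv [:: u1; u2; u3; z] -> (forall x, [lie z, x] = 0) ->
  [/\ [lie u2, u3] = u1, [lie u3, u1] = u2 & [lie u1, u2] = e *: u3] ->
  basis_of fullv [:: y1; y2; y3] ->
  [/\ [lie y2, y3] = y1, [lie y3, y1] = y2 & [lie y1, y2] = e *: y3] ->
  lie_isomorphic g (abelian_lie R 1 * h)%type.
Proof.
move=> bU zC [u23 u31 u12] bY [y23 y31 y12].
apply: (lie_isomorphic_dim4 bU (dsum_abelian1_basis bY)) => f [f1 f2 f3 fz].
rewrite !(lieC _ z) !zC (lieC u1 u3) u23 u31 u12 oppr0 linear0 linearN linearZ /=.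
rewrite f1 f2 f3.
have pair_lie (a a' : abelian_lie R 1) (y y' : h) :
  [lie (a, y), (a', y')] = (0, [lie y, y']) :> (abelian_lie R 1 * h)%type by [].
rewrite !pair_lie !lie0r y23 y12 (lieC y1 y3) y31.
by do !split; congr pair; rewrite /= ?oppr0 ?scaler0.
Qed.

Lemma simple_by_real_isomorphic (u1 u2 u3 z : g) (a1 a2 a3 : R) :
  basis_of fullv [:: u1; u2; u3; z] -> (forall x, [lie z, x] = 0) ->
  [/\ [lie u2, u3] = a1 *: u1, [lie u3, u1] = a2 *: u2
    & [lie u1, u2] = a3 *: u3] ->
  0 < a1 * a2 -> a3 != 0 ->
  lie_isomorphic g (abelian_lie R 1 * sl R 2)%type \/
  lie_isomorphic g (abelian_lie R 1 * so R 3)%type.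
Proof.
move=> bU zC [u23 u31 u12] a12 a3_nz.
have a1_nz : a1 != 0 by apply: contraTneq a12 => ->; rewrite mul0r ltxx.
(* The rescaled vectors t_i u_i should satisfy t2 t3 a1 = t1, t3 t1 a2 = t2 and t1 t2 a3 = e t3.
   Eliminating t1 leaves t3^2 a1 a2 = 1, solvable since a1 a2 > 0, and t2^2 a1 a3 = e, so that e is
   the sign of a1 a3. *)
pose t3 := (Num.sqrt (a1 * a2))^-1; pose t2 := (Num.sqrt `|a1 * a3|)^-1.
pose t1 := t2 * t3 * a1.
have a13 : a1 * a3 != 0 by rewrite mulf_neq0.
have t2_nz : t2 != 0 by rewrite invr_eq0 sqrtr_eq0 -ltNge normr_gt0.
have t3_nz : t3 != 0 by rewrite invr_eq0 sqrtr_eq0 -ltNge.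
have t1_nz : t1 != 0 by rewrite !mulf_neq0.
have t3E : t3 * t3 * (a1 * a2) = 1.
  by rewrite -expr2 exprVn sqr_sqrtr ?ltW // mulVf // gt_eqF.
have t2E : t2 * t2 * (a1 * a3) = Num.sg (a1 * a3).
  rewrite -expr2 exprVn sqr_sqrtr // {2}[a1 * a3]numEsg.
  by rewrite mulrCA mulVf ?normr_eq0 // mulr1.
have bV : basis_of fullv [:: t1 *: u1; t2 *: u2; t3 *: u3; z].
  apply: basis_of_subset_span bU _ _ => // x; rewrite !inE => xE.
  case/or4P: xE => /eqP->; last by rewrite memv_span // !inE eqxx ?orbT.
  - by apply: (@mem_span_scaled _ _ t1) => //; rewrite !inE eqxx ?orbT.
  - by apply: (@mem_span_scaled _ _ t2) => //; rewrite !inE eqxx ?orbT.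
  - by apply: (@mem_span_scaled _ _ t3) => //; rewrite !inE eqxx ?orbT.
have brV : [/\ [lie t2 *: u2, t3 *: u3] = t1 *: u1,
    [lie t3 *: u3, t1 *: u1] = t2 *: u2 &
    [lie t1 *: u1, t2 *: u2] = Num.sg (a1 * a3) *: (t3 *: u3)].
  rewrite !(lieZl, lieZr) u23 u31 u12 !scalerA -t2E /t1; split.
  - by [].
  - by congr (_ *: _); rewrite -[RHS]mulr1 -t3E; ring.
  - by congr (_ *: _); ring.
have [a13_gt0|a13_lt0|a13_0] := ltgtP 0 (a1 * a3).
- right; apply: (dsum_abelian1_isomorphic bV zC brV (so3_basis nz2)).
  rewrite gtr0_sg // scale1r.
  by split; rewrite [LHS]lie_so3_vec; congr so3_vec; ring.
- left; apply: (dsum_abelian1_isomorphic bV zC brV (sl2_basis nz2)).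
  rewrite ltr0_sg // scaleN1r.
  split; rewrite [LHS](lie_sl2_vec nz2); [congr sl2_vec; ring|congr sl2_vec; ring|].
  rewrite /sl2_vec -[RHS]linearN.
  congr (vsproj _ _); apply/matrixP => i j.
  by have [] := ord2P i => ->; have [] := ord2P j => ->; rewrite !mxE /=; field.
- by rewrite -a13_0 eqxx in a13.
Qed.

Lemma oscillator_isomorphic (y u v z : g) (c q r : R) :
  basis_of fullv [:: y; u; v; z] -> (forall x, [lie z, x] = 0) ->
  [/\ [lie y, u] = (c / r) *: v, [lie y, v] = - (c / q) *: u
    & [lie u, v] = c *: z] ->
  c != 0 -> 0 < q * r -> lie_isomorphic g (oscillator R).
Proof.
move=> bX zC [yu yv uv] c_nz qr.
have q_nz : q != 0 by apply: contraTneq qr => ->; rewrite mul0r ltxx.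
have r_nz : r != 0 by apply: contraTneq qr => ->; rewrite mulr0 ltxx.
(* In the basis t y, u, s v, s c z, the relation [t y, u] = s v forces s = t c / r, and [t y, s v] =
   - u then forces t^2 c^2 = q r. *)
pose t := Num.sqrt (q * r) / c; pose s := t * (c / r).
have t_nz : t != 0 by rewrite mulf_neq0 ?invr_eq0 // sqrtr_eq0 -ltNge.
have s_nz : s != 0 by rewrite mulf_neq0 // mulf_neq0 // invr_eq0.
have sc_nz : s * c != 0 by rewrite mulf_neq0.
have tsE : t * s * (c / q) = 1.
  have -> : t * s * (c / q) = Num.sqrt (q * r) ^+ 2 / (q * r).
    by rewrite /s /t; field; rewrite c_nz r_nz q_nz.
  by rewrite sqr_sqrtr ?ltW // divff // mulf_neq0.
have bV : basis_of fullv [:: t *: y; u; s *: v; (s * c) *: z].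
  apply: basis_of_subset_span bX _ _ => // x; rewrite !inE => xE.
  case/or4P: xE => /eqP->.
  - by apply: (@mem_span_scaled _ _ t) => //; rewrite !inE eqxx ?orbT.
  - by rewrite memv_span // !inE eqxx ?orbT.
  - by apply: (@mem_span_scaled _ _ s) => //; rewrite !inE eqxx ?orbT.
  - by apply: (@mem_span_scaled _ _ (s * c)) => //; rewrite !inE eqxx ?orbT.
apply: (@lie_isomorphic_dim4 _ g (oscillator R) _ _ _ _ _ _ _ _
  bV (delta_basis4 R)) => f [_ f1 f2 f3].
rewrite !(lieZl, lieZr) !(lieC _ z) !zC !oppr0 !scaler0 linear0 yu yv uv !scalerA.
have -> : t * s * - (c / q) = -1 by rewrite mulrN tsE.
rewrite scaleN1r linearN f1 f2 f3.
do !split; by rewrite [RHS]table_lie_basis /oscillator_table ?inordK.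
Qed.

Lemma g1_isomorphic (y u v z : g) (c q r : R) :
  basis_of fullv [:: y; u; v; z] -> (forall x, [lie z, x] = 0) ->
  [/\ [lie y, u] = (c / r) *: v, [lie y, v] = - (c / q) *: u
    & [lie u, v] = c *: z] ->
  c != 0 -> q * r < 0 -> lie_isomorphic g (g1_lie R).
Proof.
move=> bX zC [yu yv uv] c_nz qr.
have q_nz : q != 0 by apply: contraTneq qr => ->; rewrite mul0r ltxx.
have r_nz : r != 0 by apply: contraTneq qr => ->; rewrite mulr0 ltxx.
have nqr : 0 < - (q * r) by rewrite oppr_gt0.
(* Chosen so that ad (t y) exchanges u and s v; then u + s v and u - s v are eigenvectors for 1 and
   -1. *)
pose t := Num.sqrt (- (q * r)) / c; pose s := t * (c / r).
have t_nz : t != 0 by rewrite mulf_neq0 ?invr_eq0 // sqrtr_eq0 -ltNge.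
have s_nz : s != 0 by rewrite mulf_neq0 // mulf_neq0 // invr_eq0.
(* The coefficient of [z] in [u + s v, u - s v]. *)
pose k := - (2 * s * c).
have k_nz : k != 0 by rewrite /k oppr_eq0 mulf_neq0 // mulf_neq0.
have tsE : t * s * - (c / q) = 1.
  have -> : t * s * - (c / q) = Num.sqrt (- (q * r)) ^+ 2 / - (q * r).
    by rewrite /s /t; field; rewrite c_nz r_nz q_nz.
  by rewrite sqr_sqrtr ?ltW // divff // gt_eqF.
have bV : basis_of fullv [:: t *: y; u + s *: v; u - s *: v; k *: z].
  pose X := [:: t *: y; u + s *: v; u - s *: v; k *: z].
  have pS : u + s *: v \in <<X>>%VS by rewrite memv_span // !inE eqxx ?orbT.
  have mS : u - s *: v \in <<X>>%VS by rewrite memv_span // !inE eqxx ?orbT.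
  apply: basis_of_subset_span bX _ _ => // x; rewrite !inE => xE.
  case/or4P: xE => /eqP->.
  - by apply: (@mem_span_scaled _ _ t) => //; rewrite !inE eqxx ?orbT.
  - have := rpredD pS mS; rewrite addrACA subrr addr0 -mulr2n -scaler_nat.
    by rewrite rpredZeq (negPf nz2).
  - have := rpredB pS mS; rewrite opprB addrC subrKA -mulr2n -scaler_nat scalerA.
    by rewrite rpredZeq mulf_eq0 (negPf nz2) (negPf s_nz).
  - by apply: (@mem_span_scaled _ _ k) => //; rewrite !inE eqxx ?orbT.
apply: (@lie_isomorphic_dim4 _ g (g1_lie R) _ _ _ _ _ _ _ _
  bV (delta_basis4 R)) => f [_ f1 f2 f3].
have e01 : [lie t *: y, u + s *: v] = u + s *: v.
  by rewrite lieZl lieDr lieZr yu yv scalerDr !scalerA tsE scale1r addrC.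
have e02 : [lie t *: y, u - s *: v] = - (u - s *: v).
  by rewrite lieZl lieDr lieNr lieZr yu yv scalerBr !scalerA tsE scale1r opprB.
have e12 : [lie u + s *: v, u - s *: v] = k *: z.
  rewrite lieDl !lieDr !lieNr !lieZl !lieZr !liexx (lieC v) uv /k.
  rewrite !scaler0 oppr0 add0r addr0 !scalerN scalerA -opprD -scalerDl scaleNr.
  by congr (- (_ *: _)); ring.
rewrite !(lieC _ (k *: z)) !lieZl !zC !scaler0 !oppr0 linear0 -!lieZl e01 e02 e12.
rewrite linearN f1 f2 f3.
do !split; by rewrite [RHS]table_lie_basis /g1_table ?inordK.
Qed.

End Classification.

(** * Case analysis on the norm of the central vector and on signs *)

Theorem proposition2p5 (R : realType) (g : lieAlgType R)
    (dim_g : (\dim {:g} = 4)%N)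
    (metric_g : exists b : {symmetric g}, ad_invariant_metric b) :
  lie_isomorphic g (abelian_lie R 4) \/
  lie_isomorphic g (abelian_lie R 1 * sl R 2)%type \/
  lie_isomorphic g (abelian_lie R 1 * so R 3)%type \/
  lie_isomorphic g (oscillator R) \/
  lie_isomorphic g (g1_lie R).
Proof.
have nz2 : 2 != 0 :> R by rewrite pnatr_eq0.
case: metric_g => b ad_b.
have [z z_nz zC] := exists_central nz2 ad_b dim_g.
have [zz|zz] := eqVneq (b z z) 0.
  have [y [u [v [bX [c [q [r [q_nz r_nz br]]]]]]]] :=
    metric_central_isotropic nz2 ad_b dim_g zC z_nz zz.
  have [c0|c_nz] := eqVneq c 0.
    left; case: br; rewrite c0 !mul0r oppr0 !scale0r => yu yv uv.
    by apply: (abelian4_isomorphic bX); rewrite !(lieC _ z) !zC !oppr0.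
  have [qr|qr|/esym/eqP] := ltgtP 0 (q * r).
  - by do 3!right; left; apply: oscillator_isomorphic bX zC br c_nz qr.
  - by do 4!right; apply: g1_isomorphic bX zC br c_nz qr.
  - by rewrite mulf_eq0 (negPf q_nz) (negPf r_nz).
have [u1 [u2 [u3 [bX [w [q1 [q2 [q3 [[q1_nz q2_nz q3_nz] [u23 u31 u12]]]]]]]]]] :=
  metric_central_nonisotropic nz2 ad_b dim_g zC zz.
have [w0|w_nz] := eqVneq w 0.
  left; move: u23 u31 u12; rewrite w0 !mul0r !scale0r => u23 u31 u12.
  by apply: (abelian4_isomorphic bX); rewrite !(lieC _ z) !zC ?(lieC u1 u3) ?u31
    ?oppr0.
have nz q : q != 0 -> w / q != 0 by move=> q_nz; rewrite mulf_neq0 ?invr_eq0.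
move: (nz _ q1_nz) (nz _ q2_nz) (nz _ q3_nz) u23 u31 u12.
set a1 := w / q1; set a2 := w / q2; set a3 := w / q3.
move=> a1_nz a2_nz a3_nz u23 u31 u12.
suff H : lie_isomorphic g (abelian_lie R 1 * sl R 2)%type \/
    lie_isomorphic g (abelian_lie R 1 * so R 3)%type by tauto.
(* Cyclic rotation preserves the shape of the bracket table. Two of the nonzero a1, a2, a3 share a
   sign, and a rotation brings them to the first two places. *)
have rot_basis v1 v2 v3 : basis_of fullv [:: v1; v2; v3; z] ->
    basis_of fullv [:: v2; v3; v1; z].
  move=> bV; apply: basis_of_subset_span bV _ _ => // x; rewrite !inE => xE.
  apply: memv_span.
  by case/or4P: xE => /eqP->; rewrite !inE eqxx ?orbT.
have [a12|a12] := ltP 0 (a1 * a2).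
  by apply: (simple_by_real_isomorphic bX zC _ a12 a3_nz).
have [a23|a23] := ltP 0 (a2 * a3).
  by apply: (simple_by_real_isomorphic (rot_basis _ _ _ bX) zC _ a23 a1_nz).
(* Both a1 a2 and a2 a3 are now negative, and their product is a2^2 a3 a1. *)
have a31 : 0 < a3 * a1.
  have a2a2 : 0 < a2 ^+ 2 by rewrite exprn_even_gt0.
  have e : a2 ^+ 2 * (a3 * a1) = a1 * a2 * (a2 * a3) by ring.
  by rewrite -(pmulr_rgt0 _ a2a2) e nmulr_rgt0 lt_neqAle mulf_neq0.
have bX' := rot_basis _ _ _ (rot_basis _ _ _ bX).
by apply: (simple_by_real_isomorphic bX' zC _ a31 a2_nz).
Qed.
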